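(* Consider the Hamiltonian SDE with additive Lévy noise in the sense of Marcus $$dP=-\sigma_0(P,Q)\,dt-\sum_{r=1}^m \sigma_r(t)\diamond dL^r(t),\quad P(t_0)=p,$$ $$dQ=\gamma_0(P,Q)\,dt+\sum_{r=1}^m \gamma_r(t)\diamond dL^r(t),\quad Q(t_0)=q,$$ where $P,Q,p,q$ are $n$-dimensional, $\sigma_0=\frac{\partial H_0}{\partial Q}$, $\gamma_0=\frac{\partial H_0}{\partial P}$, and for $r=1,\dots,m$ the coefficients $\sigma_r=\frac{\partial H_r}{\partial Q}$, $\gamma_r=\frac{\partial H_r}{\partial P}$ depend on $t$ only. Let $t_0<t_1<\dots<t_N$, $\Delta t_j=t_{j+1}-t_j$, and let $(P_j,Q_j)$ be given by the semi-implicit Euler scheme $$P_{j+1}=P_j-\sigma_0(P_{j+1},Q_j)\,\Delta t_j-\sum_{r=1}^m\sigma_r(t_j)\diamond\Delta L^r(t_j),\quad P_0=p,$$ $$Q_{j+1}=Q_j+\gamma_0(P_{j+1},Q_j)\,\Delta t_j+\sum_{r=1}^m\gamma_r(t_j)\diamond\Delta L^r(t_j),\quad Q_0=q.$$ Then the scheme preserves the symplectic structure, i.e. $$dP_{j+1}\wedge dQ_{j+1}=dP_j\wedge dQ_j,\qquad j=0,1,\dots,N-1.$$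
   Context: Setting: $(\Omega,\mathcal F,\{\mathcal F_t\}_{t\ge0},\mathbb P)$ is a filtered probability space; $L^1,\dots,L^m$ are the real-valued components of a square integrable Lévy process. $H_0(P,Q)$ is a twice continuously differentiable Hamiltonian on $\mathbb R^{2n}$ (with $P,Q\in\mathbb R^n$). The Hamiltonian vector fields are such that the SDE has a unique global solution which is adapted and càdlàg. Standing assumption (Assumption 1): there is a constant $K$ with $|\sigma_0(X_1)-\sigma_0(X_2)|\le K|X_1-X_2|$ and $|\gamma_0(X_1)-\gamma_0(X_2)|\le K|X_1-X_2|$ for all $X_i=(P_i,Q_i)$, $i=1,2$. Discrete Marcus terms: $\Delta L^r(t_j)=L^r(t_{j+1})-L^r(t_j)$, and $\Delta L^r(s)=L^r(s)-L^r(s-)$ is the jump of $L^r$ at time $s$ inside the sums below. By definition, $$\sigma_r(t_j)\diamond\Delta L^r(t_j)=\sigma_r(t_j)\Delta L^r(t_j)+\sum_{t_j\le s\le t_{j+1}}\Big[\Phi_1^r(\Delta L^r(s),\sigma_r(t_j),P_j)-P_j-\sigma_r(t_j)\Delta L^r(s)\Big],$$ $$\gamma_r(t_j)\diamond\Delta L^r(t_j)=\gamma_r(t_j)\Delta L^r(t_j)+\sum_{t_j\le s\le t_{j+1}}\Big[\Phi_2^r(\Delta L^r(s),\gamma_r(t_j),Q_j)-Q_j-\gamma_r(t_j)\Delta L^r(s)\Big],$$ where $\Phi_1^r(l,\sigma_r(t_j),P_j)=\xi_1^r(1)$ and $\Phi_2^r(l,\gamma_r(t_j),Q_j)=\xi_2^r(1)$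 with $\frac{d\xi_1^r}{d\hat s}=\sigma_r(t_j)l$, $\xi_1^r(0)=P_j$, and $\frac{d\xi_2^r}{d\hat s}=\gamma_r(t_j)l$, $\xi_2^r(0)=Q_j$, $\hat s\in[0,1]$. Symplectic structure: $dP\wedge dQ=\sum_{i=1}^n dP^i\wedge dQ^i$ for $P=(P^1,\dots,P^n)$, $Q=(Q^1,\dots,Q^n)$. The differentials $dP_{j+1},dQ_{j+1}$ are those of the one-step map $(P_j,Q_j)\mapsto(P_{j+1},Q_{j+1})$, for a fixed realization of the noise; the implicit equation for $P_{j+1}$ is understood to define $P_{j+1}$ as a differentiable function of $(P_j,Q_j)$. *)

(* Defs.v *)
From mathcomp Require Import all_boot all_order all_algebra.
From mathcomp Require Import all_classical all_reals all_analysis.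
From mathcomp.analysis.showcase Require summability.

Set Implicit Arguments.
Unset Strict Implicit.
Unset Printing Implicit Defensive.
Import Order.TTheory GRing.Theory Num.Theory.
Import numFieldNormedType.Exports.

Local Open Scope classical_set_scope.
Local Open Scope ring_scope.

Section Smoothness.
Context {R : realType} {E : normedModType R}.

Definition continuously_differentiable (f : E -> R) : Prop :=
  (forall x, differentiable f x) /\ (forall v, continuous (fun x => 'D_v f x)).

Definition twice_continuously_differentiable (f : E -> R) : Prop :=
  continuously_differentiable f /\
  (forall v, continuously_differentiable (fun x => 'D_v f x)).

End Smoothness.

(* Phase space is 'rV_n * 'rV_n; the first component is P, the second is Q. *)
Section PhaseSpace.
Context {R : realType} {n : nat}.
Local Notation V := 'rV[R]_n.

Definition gradP (H : V * V -> R) (X : V * V) : V :=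
  \row_(i < n) 'D_(delta_mx 0 i, 0) H X.

Definition gradQ (H : V * V -> R) (X : V * V) : V :=
  \row_(i < n) 'D_(0, delta_mx 0 i) H X.

Definition wedge (a b : V * V -> R) (u v : V * V) : R := a u * b v - a v * b u.

(* The 2-form dA /\ dB = \sum_i dA^i /\ dB^i at the point X, evaluated on the
   tangent vectors u and v. *)
Definition wedge_form (A B : V * V -> V) (X u v : V * V) : R :=
  \sum_(i < n) wedge ('d (fun Y => A Y 0 i) X) ('d (fun Y => B Y 0 i) X) u v.

End PhaseSpace.

Section Paths.
Context {R : realType}.

Definition left_limit {T : ptopologicalType} (f : R -> T) (s : R) : T :=
  lim (f x @[x --> s^'-]).

Definition cadlag {T : ptopologicalType} (a : R) (f : R -> T) : Prop :=
  forall t : R, a <= t ->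
    (f x @[x --> t^'+] --> f t) /\ (a < t -> cvg (f x @[x --> t^'-])).

(* Paths only matter on [0, +oo[, and do not jump at time 0. *)
Definition jump (f : R -> R) (s : R) : R :=
  if 0 < s then f s - left_limit f s else 0.

End Paths.

Section Marcus.
Context {R : realType} {n : nat}.
Local Notation V := 'rV[R]_n.

Definition marcus_ode (l : R) (v x : V) (xi : R -> V) : Prop :=
  [/\ xi 0 = x, {within `[0, 1], continuous xi} &
      forall s : R, s \in `]0, 1[ -> is_derive s (1 : R) xi (l *: v)].

Definition marcus_Phi (l : R) (v x : V) : V :=
  (get [set xi | marcus_ode l v x xi]) 1.

(* The sum over the (uncountable) set A is the limit of the finite partial
   sums; here l s is the jump at time s, v s the coefficient, x s the state. *)
Definition marcus_correction (A : set R) (l : R -> R) (v x : R -> V) : V :=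
  summability.sum (fun s : R =>
    if s \in A then marcus_Phi (l s) (v s) (x s) - x s - l s *: v s else 0).

(* v <> (Z b - Z a), with coefficient v and state x frozen on [a, b] *)
Definition marcus_increment (Z : R -> R) (v : V) (a b : R) (x : V) : V :=
  (Z b - Z a) *: v +
  marcus_correction `[a, b] (jump Z) (fun=> v) (fun=> x).

(* One step (x, y) |-> (x', y') of the semi-implicit Euler scheme on [a, b] *)
Definition euler_step {m : nat} (H0 : V * V -> R) (sigma gamma : 'I_m -> R -> V)
    (Z : 'I_m -> R -> R) (a b : R) (x y x' y' : V) : Prop :=
  x' = x - (b - a) *: gradQ H0 (x', y)
         - \sum_(r < m) marcus_increment (Z r) (sigma r a) a b x /\
  y' = y + (b - a) *: gradP H0 (x', y)
         + \sum_(r < m) marcus_increment (Z r) (gamma r a) a b y.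

End Marcus.

Section Processes.
Context {R : realType} {d : measure_display} {Omega : measurableType d}.
Variable Pr : probability Omega R.

Record filtration (F : R -> set (set Omega)) : Prop := {
  filtration_sigma_algebra : forall t : R, 0 <= t -> sigma_algebra setT (F t) ;
  filtration_measurable : forall t : R, 0 <= t -> F t `<=` measurable ;
  filtration_nondecreasing : forall s t : R, 0 <= s -> s <= t -> F s `<=` F t }.

Definition adapted (F : R -> set (set Omega)) (a : R) (Z : R -> Omega -> R) :=
  forall t : R, a <= t -> forall B : set R, measurable B -> F t (Z t @^-1` B).

(* Independence and stationarity of the R^m-valued increments are stated on
   measurable rectangles, which form a pi-system generating the Borel sets. *)
Record square_integrable_levy {m : nat} (F : R -> set (set Omega))
    (L : 'I_m -> R -> Omega -> R) : Prop := {
  levy_adapted : forall r, adapted F 0 (L r) ;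
  levy_start : forall r, {ae Pr, forall w, L r 0 w = 0} ;
  levy_independent : forall s t : R, 0 <= s -> s <= t ->
    forall (A : set Omega) (B : 'I_m -> set R),
      F s A -> (forall r, measurable (B r)) ->
      let D := [set w | forall r, B r (L r t w - L r s w)] in
      Pr (A `&` D) = (Pr A * Pr D)%E ;
  levy_stationary : forall s t : R, 0 <= s -> s <= t ->
    forall B : 'I_m -> set R, (forall r, measurable (B r)) ->
      Pr [set w | forall r, B r (L r t w - L r s w)] =
      Pr [set w | forall r, B r (L r (t - s) w - L r 0 w)] ;
  levy_stochastically_continuous : forall r (s e : R), 0 <= s -> 0 < e ->
    Pr [set w | e <= `|L r t w - L r s w|]
      @[t --> within [set t : R | 0 <= t] (nbhs s)] --> 0%E ;
  levy_cadlag : forall r, {ae Pr, forall w, cadlag 0 (L r ^~ w)} ;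
  levy_square_integrable : forall r (t : R), 0 <= t ->
    ('E_Pr[fun w => (L r t w ^+ 2)%R] < +oo)%E }.

(* Ito integral I of a deterministic integrand f over ]a, b]: limit in
   probability of the elementary integrals of step functions approximating f
   in L^2. By the Ito isometry, I does not depend on the approximation, up to
   null sets. *)
Definition is_ito_integral (Z : R -> Omega -> R) (f : R -> R) (a b : R)
    (I : Omega -> R) : Prop :=
  [/\ measurable_fun `[a, b] f, measurable_fun setT I &
  exists (K : nat -> nat) (g c : nat -> nat -> R),
  [/\ forall k, g k 0%N = a /\ g k (K k) = b,
      forall k i, g k i <= g k i.+1,
      (\int[lebesgue_measure]_(s in `[a, b])
         ((f s - \sum_(i < K k) c k i * \1_(`]g k i, g k i.+1]%classic) s)
            ^+ 2)%:E)%E @[k --> \oo] --> 0%E &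
      forall e : R, 0 < e ->
        Pr [set w | e <= `|\sum_(i < K k) c k i * (Z (g k i.+1) w - Z (g k i) w)
                           - I w|] @[k --> \oo] --> 0%E]].

Section SDE.
Context {n m : nat}.
Local Notation V := 'rV[R]_n.

(* Marcus integral of v against Z over ]a, b] along the state process Y. As v
   does not depend on the state, the correction term for the continuous part of
   Z, which involves the derivative of v in the state, is zero. *)
Definition is_marcus_integral (Z : R -> Omega -> R) (v : R -> V)
    (Y : R -> Omega -> V) (a b : R) (M : Omega -> V) : Prop :=
  exists I : Omega -> V,
    (forall i, is_ito_integral Z (fun s => v s 0 i) a b (fun w => I w 0 i)) /\
    {ae Pr, forall w, M w = I w +
       marcus_correction `]a, b] (jump (Z ^~ w)) v (left_limit (Y ^~ w))}.

Definition path_integral (a b : R) (f : R -> V) : V :=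
  \row_(i < n) Rintegral lebesgue_measure `[a, b] (fun s => f s 0 i).

Record sde_solution (F : R -> set (set Omega)) (L : 'I_m -> R -> Omega -> R)
    (H0 : V * V -> R) (sigma gamma : 'I_m -> R -> V) (t0 : R) (p q : V)
    (P Q : R -> Omega -> V) : Prop := {
  sde_adapted : forall i, adapted F t0 (fun t w => P t w 0 i) /\
                          adapted F t0 (fun t w => Q t w 0 i) ;
  sde_cadlag : {ae Pr, forall w, cadlag t0 (P ^~ w) /\ cadlag t0 (Q ^~ w)} ;
  sde_equation : forall t : R, t0 <= t ->
    exists MP MQ : 'I_m -> Omega -> V,
    [/\ forall r, is_marcus_integral (L r) (sigma r) P t0 t (MP r),
        forall r, is_marcus_integral (L r) (gamma r) Q t0 t (MQ r) &
        {ae Pr, forall w,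
          P t w = p - path_integral t0 t (fun s => gradQ H0 (P s w, Q s w))
                    - \sum_(r < m) MP r w /\
          Q t w = q + path_integral t0 t (fun s => gradP H0 (P s w, Q s w))
                    + \sum_(r < m) MQ r w}] }.

(* Uniqueness is up to indistinguishability. *)
Definition sde_well_posed (F : R -> set (set Omega))
    (L : 'I_m -> R -> Omega -> R) (H0 : V * V -> R)
    (sigma gamma : 'I_m -> R -> V) (t0 : R) (p q : V) : Prop :=
  (exists P Q, sde_solution F L H0 sigma gamma t0 p q P Q) /\
  (forall P Q P' Q', sde_solution F L H0 sigma gamma t0 p q P Q ->
     sde_solution F L H0 sigma gamma t0 p q P' Q' ->
     {ae Pr, forall w, forall t : R, t0 <= t -> P t w = P' t w /\ Q t w = Q' t w}).

End SDE.
End Processes.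

(* Main.v *)
(** For a fixed noise path the Marcus flow of a frozen coefficient is a
    translation, so each noise term is independent of the state and the
    one-step map has the form
      [A(x, y) = x - h H_y(A, y) - c1], [B(x, y) = y + h H_x(A, y) + c2].
    Differentiating both equations expresses [dA /\ dB - dx /\ dy] through the
    second derivative of [H] at [(A, y)], and all these terms cancel because
    the second derivative is symmetric. *)
Require Import Defs.
From mathcomp Require Import all_boot all_order all_algebra.
From mathcomp Require Import all_classical all_reals all_analysis.
From mathcomp Require Import ring.
Set Implicit Arguments.
Unset Strict Implicit.
Unset Printing Implicit Defensive.
Import Order.TTheory GRing.Theory Num.Theory.
Import numFieldNormedType.Exports.
Local Open Scope classical_set_scope.
Local Open Scope ring_scope.

(** * Symmetry of the second derivative *)

Lemma is_diff_line (R : realType) (E : normedModType R) (x u : E) (s : R) :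
  is_diff s (fun r : R => x + r *: u) (fun r : R => r *: u).
Proof.
apply: (is_diff_eq (is_diffD (is_diff_cst x s) (is_diff_scalel s u))).
by apply/funext => r; rewrite /= add0r.
Qed.

Lemma is_derive_line (R : realType) (E : normedModType R) (f : E -> R)
    (x u : E) (s : R) : differentiable f (x + s *: u) ->
  is_derive s (1 : R) (fun r : R => f (x + r *: u)) ('D_u f (x + s *: u)).
Proof.
move=> df.
have dl := is_diff_line x u s.
have dfl : differentiable (fun r : R => f (x + r *: u)) s.
  by apply: (@differentiable_comp _ _ _ _ (fun r : R => x + r *: u) f).
apply: DeriveDef; first exact: diff_derivable.
rewrite deriveE// (@diff_comp _ _ _ _ (fun r : R => x + r *: u) f)//=.
by rewrite diff_val scale1r deriveE.
Qed.

Lemma MVT_line (R : realType) (E : normedModType R) (f : E -> R)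
    (x y u : E) (h : R) : 0 < h -> (forall z, differentiable f z) ->
  exists2 c, c \in `]0, h[%R &
    (f (y + h *: u) - f (x + h *: u)) - (f y - f x) =
    ('D_u f (y + c *: u) - 'D_u f (x + c *: u)) * h.
Proof.
move=> h0 df.
pose g (s : R) := f (y + s *: u) - f (x + s *: u).
have dg (s : R) : is_derive s (1 : R) g ('D_u f (y + s *: u) - 'D_u f (x + s *: u)).
  by apply: is_deriveB; apply: is_derive_line.
have [|c ch] := MVT h0 (fun s _ => dg s).
  by apply: derivable_within_continuous => s _; case: (dg s).
by rewrite /g !scale0r !addr0 subr0 => e; exists c.
Qed.

(** The mean value theorem is used twice: along [u] for the difference of [f] based at [x + h *: v]
    and [x], then along [v] for ['D_u f]. *)
Lemma second_difference (R : realType) (E : normedModType R) (f : E -> R)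
    (x u v : E) (h : R) : 0 < h -> (forall z, differentiable f z) ->
    (forall z, differentiable (fun y => 'D_u f y) z) ->
  exists a b, [/\ a \in `]0, h[%R, b \in `]0, h[%R &
    f (x + h *: v + h *: u) - f (x + h *: u) - (f (x + h *: v) - f x) =
    'D_v (fun y => 'D_u f y) (x + a *: u + b *: v) * h * h].
Proof.
move=> h0 df ddf.
have [a ah ->] := MVT_line x (x + h *: v) u h0 df.
have [b bh eb] := MVT_line (x + a *: u) (x + a *: u) v h0 ddf.
have db (s : R) : is_derive s (1 : R) (fun r : R => 'D_u f (x + a *: u + r *: v))
    ('D_v (fun y => 'D_u f y) (x + a *: u + s *: v)).
  exact: is_derive_line.
(* This second application is to ['D_u f (x + a *: u + r *: v)] as a function of [r]; its point and
   equation replace the previous ones. *)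
have [|{eb}b {}bh eb] := MVT h0 (fun s _ => db s).
  by apply: derivable_within_continuous => s _; case: (db s).
exists a, b; split=> //.
by rewrite scale0r addr0 subr0 in eb; rewrite addrAC eb.
Qed.

(* The second difference is symmetric in [u] and [v], so both mixed derivatives
   take a common value at points arbitrarily close to [x]. *)
Lemma derive_commute (R : realType) (E : normedModType R) (f : E -> R)
    (x u v : E) : twice_continuously_differentiable f ->
  'D_u (fun y => 'D_v f y) x = 'D_v (fun y => 'D_u f y) x.
Proof.
move=> [[df _] ddf].
have near_x w z e : 0 < e -> exists2 d, 0 < d & forall y, `|y - x| < d ->
    `|'D_w (fun y => 'D_z f y) y - 'D_w (fun y => 'D_z f y) x| < e.
  move=> e0; have [_ /(_ w x)/cvgrPdist_lt/(_ e e0)/nbhs_normP[d /= d0 hd]] := ddf z.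
  by exists d => // y yd; rewrite distrC; apply: hd; rewrite /= distrC.
apply/eqP; rewrite -subr_eq0 -normr_le0; apply/ler_addgt0Pl => e e0; rewrite addr0.
have e2 : 0 < e / 2 by rewrite divr_gt0.
have [d1 d10 h1] := near_x u v _ e2; have [d2 d20 h2] := near_x v u _ e2.
pose d := Num.min d1 d2; have d0 : 0 < d by rewrite lt_min d10.
(* With this step size, [h * (|u| + |v|) < d]; the summand 1 keeps the denominator positive and the
   inequality strict. *)
pose h := d / (1 + `|u| + `|v|).
have n0 : 0 < 1 + `|u| + `|v| by rewrite -addrA ltr_pwDl// addr_ge0.
have h0 : 0 < h by rewrite divr_gt0.
have close a b w z : a \in `]0, h[%R -> b \in `]0, h[%R ->
    `|w| + `|z| = `|u| + `|v| -> `|x + a *: w + b *: z - x| < d.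
  rewrite !in_itv /= => /andP[a0 ah] /andP[b0 bh] wz.
  rewrite -(addrA x) (addrC x) addrK.
  apply: (le_lt_trans (ler_normD _ _)).
  rewrite !normrZ !gtr0_norm//.
  have hw : a * `|w| <= h * `|w| by rewrite ler_wpM2r// ltW.
  have hz : b * `|z| <= h * `|z| by rewrite ler_wpM2r// ltW.
  apply: (le_lt_trans (lerD hw hz)).
  rewrite -mulrDr wz -[ltRHS](divfK (lt0r_neq0 n0)) -/h ltr_pM2l//.
  by rewrite -addrA ltrDr.
have [a [b [ah bh eab]]] := second_difference x v h0 df (fst (ddf u)).
have [a' [b' [a'h b'h eab']]] := second_difference x u h0 df (fst (ddf v)).
(* Both second differences combine the same four values of [f]; cancelling [h] twice equates the
   mixed derivatives at the two points. *)
have eq12 : 'D_u (fun y => 'D_v f y) (x + a' *: v + b' *: u) =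
            'D_v (fun y => 'D_u f y) (x + a *: u + b *: v).
  apply: (mulIf (lt0r_neq0 h0)); apply: (mulIf (lt0r_neq0 h0)).
  apply: etrans (esym eab') (etrans _ eab); rewrite (addrAC x (h *: u)).
  move: (f (x + h *: v + h *: u)) (f (x + h *: v)) (f (x + h *: u)) (f x).
  by move=> A B C D; ring.
have /h1 l1 : `|x + a' *: v + b' *: u - x| < d1.
  by apply: lt_le_trans (close _ _ _ _ a'h b'h (addrC _ _)) _; rewrite ge_min lexx.
have /h2 l2 : `|x + a *: u + b *: v - x| < d2.
  by apply: lt_le_trans (close _ _ _ _ ah bh erefl) _; rewrite ge_min lexx orbT.
rewrite eq12 distrC in l1.
by rewrite (splitr e); apply/ltW/(le_lt_trans (ler_distD _ _ _))/ltrD; [exact: l1|exact: l2].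
Qed.

(** * Marcus increments with a frozen coefficient *)

(** The affine path solves the equation, so [get] returns some solution; each coordinate of that
    solution has constant derivative on the open unit interval, and the mean value theorem fixes its
    value at 1. *)
Lemma marcus_PhiE (R : realType) (n : nat) (l : R) (v x : 'rV[R]_n) :
  marcus_Phi l v x = x + l *: v.
Proof.
have ex : marcus_ode l v x (fun s => x + s *: (l *: v)).
  have dr (s : R) : is_derive s (1 : R) (fun r : R => x + r *: (l *: v)) (l *: v).
    have dl := is_diff_line x (l *: v) s.
    apply: DeriveDef; first exact: diff_derivable.
    by rewrite deriveE// diff_val scale1r.
  split; [by rewrite scale0r addr0| |by move=> s _; exact: dr].
  by apply: derivable_within_continuous => s _; case: (dr s).
rewrite /marcus_Phi; have := getI ex.
set xi := get _; case=> xi0 xic dxi.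
apply/rowP => i.
have dxi_i (s : R) : s \in `]0, 1[%R ->
    is_derive s (1 : R) (fun r => xi r 0 i) ((l *: v) 0 i).
  move=> /dxi[dxs es]; apply: DeriveDef; first exact: (derivable_mxP _ _ _).1 dxs 0 i.
  by rewrite -es derive_mx// mxE.
have xi_i : {within `[(0 : R), 1], continuous (fun s => xi s 0 i)}.
  move=> s; apply: (@cvg_comp _ _ _ xi (fun M : 'rV[R]_n => M 0 i) _ _ _ (xic s)).
  exact: coord_continuous.
have [c _] := MVT ltr01 dxi_i xi_i.
by rewrite subr0 mulr1 xi0 !mxE => <-; rewrite subrKC.
Qed.

(** The state cancels in [marcus_Phi l v x - x], so the two corrections sum the same function. *)
Lemma marcus_increment_cst (R : realType) (n : nat) (Z : R -> R)
    (v : 'rV[R]_n) (a b : R) (x y : 'rV[R]_n) :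
  marcus_increment Z v a b x = marcus_increment Z v a b y.
Proof.
rewrite /marcus_increment /marcus_correction.
congr (_ + summability.sum _); apply/funext => s.
by rewrite !marcus_PhiE (addrC x) addrK (addrC y) addrK.
Qed.

(** * Differentials and second derivatives on phase space *)

Section PhaseSpace.
Context (R : realType) (n : nat).
Local Notation V := 'rV[R]_n.

Lemma is_diff_row (E : normedModType R) (A dA : E -> V) (X : E) (i : 'I_n) :
  is_diff X A dA -> is_diff X (fun Y => A Y 0 i) (fun u => dA u 0 i).
Proof.
move=> [diffA <-].
have diffAi : differentiable (fun Y => A Y 0 i) X.
  exact: (differentiable_comp diffA (differentiable_coord _ _ _)).
apply: DiffDef => //; apply/funext => u.
by rewrite -!deriveE// derive_mx ?mxE//; exact: diff_derivable.
Qed.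

(** The first-order expansion of [g] at [X] is also one of [f], and such an expansion determines the
    differential. *)
Lemma near_eq_is_diff (E : normedModType R) (f g : E -> R) (X : E)
    (dg : E -> R) :
  (\forall Z \near X, f Z = g Z) -> is_diff X g dg -> is_diff X f dg.
Proof.
move=> fg [diffg <-]; have cdg := diff_continuous diffg.
have fE : f \o shift X = cst (f X) + 'd g X +o_ 0 id.
  apply/eqaddoP => e e0; have /eqaddoP/(_ e e0) := diff_locally diffg.
  have : \forall Z \near 0, f (Z + X) = g (Z + X).
    by move: fg; rewrite (near_shift 0) subr0.
  by apply: filterS2 => Z fgZ; rewrite !fctE/= fgZ (nbhs_singleton fg).
have dfE := diff_unique cdg fE.
apply: DiffDef (dfE); apply/diff_locallyP.
by split; [rewrite dfE; exact: cdg|rewrite dfE; exact: fE].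
Qed.

Lemma is_diff_fst (U W : normedModType R) (X : U * W) :
  is_diff X (fst : U * W -> U) fst.
Proof.
have cf : continuous (fst : U * W -> U) by move=> Z; exact: cvg_fst.
by apply: DiffDef; [exact: linear_differentiable|exact: diff_lin].
Qed.

Lemma is_diff_snd (U W : normedModType R) (X : U * W) :
  is_diff X (snd : U * W -> W) snd.
Proof.
have cf : continuous (snd : U * W -> W) by move=> Z; exact: cvg_snd.
by apply: DiffDef; [exact: linear_differentiable|exact: diff_lin].
Qed.

(** Linearity in [u] is that of the differential of ['D_v f]; linearity in [v] is reached through
    symmetry. *)
Definition hess (f : V * V -> R) (Y u v : V * V) : R :=
  'D_u (fun X => 'D_v f X) Y.

Lemma wedge_form_diff (A B : V * V -> V) (X : V * V) (a b : 'I_n -> V * V -> R) :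
  (forall i, is_diff X (fun Z => A Z 0 i) (a i)) ->
  (forall i, is_diff X (fun Z => B Z 0 i) (b i)) ->
  forall u v, wedge_form A B X u v =
    \sum_(i < n) a i u * b i v - \sum_(i < n) a i v * b i u.
Proof.
move=> dA dB u v; rewrite -sumrB; apply: eq_bigr => i _.
by have [_ Ea] := dA i; have [_ Eb] := dB i; rewrite /wedge Ea Eb.
Qed.

Variables (f : V * V -> R) (Y : V * V).
Hypothesis f2 : twice_continuously_differentiable f.

Lemma hessC u v : hess f Y u v = hess f Y v u.
Proof. exact: derive_commute. Qed.

Lemma hessE u v : hess f Y u v = 'd (fun X => 'D_v f X) Y u.
Proof. by rewrite /hess deriveE//; case: f2 => _ /(_ v)[]. Qed.

Lemma hessDl u u' v : hess f Y (u + u') v = hess f Y u v + hess f Y u' v.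
Proof. by rewrite !hessE linearD. Qed.

Lemma pair_split (u : V * V) : u = (u.1, 0) + (0, u.2).
Proof. by case: u => a b; congr pair; rewrite ?addr0 ?add0r. Qed.

Lemma hess_sum_fst u (c : V) :
  \sum_i c 0 i * hess f Y u (delta_mx 0 i, 0) = hess f Y u (c, 0).
Proof.
have -> : (c, 0) = \sum_i c 0 i *: ((delta_mx 0 i, 0) : V * V).
  apply: injective_projections; rewrite /= raddf_sum/=.
    exact: row_sum_delta.
  by rewrite big1// => i _; rewrite scaler0.
rewrite hessC hessE linear_sum; apply: eq_bigr => i _.
by rewrite linearZ/= -hessE hessC.
Qed.

Lemma hess_sum_snd u (c : V) :
  \sum_i c 0 i * hess f Y u (0, delta_mx 0 i) = hess f Y u (0, c).
Proof.
have -> : (0, c) = \sum_i c 0 i *: ((0, delta_mx 0 i) : V * V).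
  apply: injective_projections; rewrite /= raddf_sum/=.
    by rewrite big1// => i _; rewrite scaler0.
  exact: row_sum_delta.
rewrite hessC hessE linear_sum; apply: eq_bigr => i _.
by rewrite linearZ/= -hessE hessC.
Qed.

End PhaseSpace.

(** * Symplecticity of the implicit one-step map *)

Lemma implicit_map_symplectic (R : realType) (n : nat)
    (f : 'rV[R]_n * 'rV[R]_n -> R) (h : R) (c1 c2 : 'rV[R]_n)
    (A B : 'rV[R]_n * 'rV[R]_n -> 'rV[R]_n) (X : 'rV[R]_n * 'rV[R]_n) :
  twice_continuously_differentiable f -> differentiable A X ->
  (\forall Z \near X, A Z = Z.1 - h *: gradQ f (A Z, Z.2) - c1) ->
  (\forall Z \near X, B Z = Z.2 + h *: gradP f (A Z, Z.2) + c2) ->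
  forall u v, wedge_form A B X u v = wedge_form fst snd X u v.
Proof.
move=> f2 dA eA eB.
pose Y := (A X, X.2).
pose da u : 'rV[R]_n * 'rV[R]_n := ('d A X u, u.2).
have dPhi : is_diff X (fun Z => (A Z, Z.2)) da.
  by apply: is_diff_pair; [exact: DiffDef|exact: is_diff_snd].
have dgrad e : is_diff X (fun Z => 'D_e f (A Z, Z.2))
    (fun u => hess f Y (da u) e).
  have [dP eP] := dPhi.
  have dfe : differentiable (fun Z => 'D_e f Z) Y by case: f2 => _ /(_ e)[].
  apply: DiffDef; first exact: (differentiable_comp dP dfe).
  apply: etrans (diff_comp dP dfe) _.
  by apply/funext => u; rewrite hessE//= eP.
have dXi i := is_diff_row i (is_diff_fst X).
have dYi i := is_diff_row i (is_diff_snd X).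
have dAi i := is_diff_row i (differentiableP dA).
(* The vector ['d A X u] also occurs inside [da u]: this linearized equation is used as an identity
   and never solved for ['d A X u]. *)
have dAE i u : ('d A X u) 0 i = u.1 0 i - h * hess f Y (da u) (0, delta_mx 0 i).
  have eAi : \forall Z \near X, A Z 0 i =
      Z.1 0 i - h *: 'D_(0, delta_mx 0 i) f (A Z, Z.2) - c1 0 i.
    by apply: filterS eA => Z {1}->; rewrite !mxE.
  have dr := is_diffB (is_diffB (dXi i)
    (is_diffZ h (dgrad (0, delta_mx 0 i)))) (is_diff_cst (c1 0 i) X).
  transitivity ('d (fun Z => A Z 0 i) X u); first by have [_ ->] := dAi i.
  have [_ ->] := near_eq_is_diff eAi dr.
  by rewrite !fctE/= subr0.
pose b (i : 'I_n) (u : 'rV[R]_n * 'rV[R]_n) : R :=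
  u.2 0 i + h * hess f Y (da u) (delta_mx 0 i, 0).
(* Differentiability of [B] comes from its equation, which is explicit once [A] is known. *)
have dBi i : is_diff X (fun Z => B Z 0 i) (b i).
  have eBi : \forall Z \near X, B Z 0 i =
      Z.2 0 i + h *: 'D_(delta_mx 0 i, 0) f (A Z, Z.2) + c2 0 i.
    by apply: filterS eB => Z {1}->; rewrite !mxE.
  have dr := is_diffD (is_diffD (dYi i)
    (is_diffZ h (dgrad (delta_mx 0 i, 0)))) (is_diff_cst (c2 0 i) X).
  by apply: is_diff_eq (near_eq_is_diff eBi dr) _; apply/funext => u;
    rewrite !fctE/= addr0.
move=> u v.
(* [dAE] is substituted only where ['d A X u'] multiplies [v'.2]; elsewhere it stays whole, as a
   direction of [hess]. *)
have sumE u' v' : \sum_i ('d A X u') 0 i * b i v' =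
    \sum_i u'.1 0 i * v'.2 0 i - h * hess f Y (da u') (0, v'.2)
    + h * hess f Y (da v') ('d A X u', 0).
  under eq_bigr do rewrite mulrDr mulrCA.
  rewrite big_split/= -mulr_sumr hess_sum_fst//; congr (_ + _).
  under eq_bigr do rewrite dAE mulrBl -mulrA.
  rewrite sumrB -mulr_sumr -hess_sum_snd//; congr (_ - _ * _).
  by apply: eq_bigr => i _; rewrite mulrC.
apply: etrans (wedge_form_diff dAi dBi u v) _.
apply: etrans _ (esym (wedge_form_diff dXi dYi u v)).
apply: etrans (congr2 (fun r s => r - s) (sumE u v) (sumE v u)) _ => /=.
(* The terms in [h] amount to [h * (hess (da v) (da u) - hess (da u) (da v))]. Splitting yields
   eight values of [hess], which symmetry reduces to the four named below. *)
rewrite /da [in LHS](pair_split ('d A X u, u.2)) [in LHS](pair_split ('d A X v, v.2)) /=.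
rewrite !hessDl//.
rewrite (hessC _ f2 (0, v.2) ('d A X u, 0)) (hessC _ f2 (0, u.2) ('d A X v, 0)).
rewrite (hessC _ f2 (0, v.2) (0, u.2)) (hessC _ f2 ('d A X v, 0) ('d A X u, 0)).
move: (\sum_i _) (\sum_i _) => r s.
move: (hess f Y (0, u.2) _) => a1; move: (hess f Y _ ('d A X v, 0)) => a2.
move: (hess f Y _ (0, v.2)) (hess f Y _ (0, u.2)) => a3 a4.
ring.
Qed.

Unset Implicit Arguments.

Theorem theorem3p2 (R : realType) (d : measure_display)
  (Omega : measurableType d) (Pr : probability Omega R)
  (F : R -> set (set Omega)) (m n : nat) (L : 'I_m -> R -> Omega -> R)
  (H0 : 'rV[R]_n * 'rV[R]_n -> R)
  (H : 'I_m -> R -> 'rV[R]_n * 'rV[R]_n -> R)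
  (sigma gamma : 'I_m -> R -> 'rV[R]_n)
  (p q : 'rV[R]_n) (N : nat) (t : nat -> R)
  (P Q : nat -> Omega -> 'rV[R]_n)
  (U : nat -> Omega -> set ('rV[R]_n * 'rV[R]_n))
  (Pmap Qmap : nat -> Omega -> 'rV[R]_n * 'rV[R]_n -> 'rV[R]_n)
  (hF : filtration F)
  (hL : square_integrable_levy Pr F L)
  (hH0 : twice_continuously_differentiable H0)
  (* Assumption on sigma_0 = dH_0/dQ and gamma_0 = dH_0/dP *)
  (hLip : exists K : R, forall X1 X2 : 'rV[R]_n * 'rV[R]_n,
     `|gradQ H0 X1 - gradQ H0 X2| <= K * `|X1 - X2| /\
     `|gradP H0 X1 - gradP H0 X2| <= K * `|X1 - X2|)
  (* additive noise *)
  (hH : forall r (s : R) (X : 'rV[R]_n * 'rV[R]_n), 0 <= s ->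
     [/\ differentiable (H r s) X, gradQ (H r s) X = sigma r s &
         gradP (H r s) X = gamma r s])
  (ht0 : 0 <= t 0%N)
  (ht : forall j, (j < N)%N -> t j < t j.+1)
  (hSDE : sde_well_posed Pr F L H0 sigma gamma (t 0%N) p q)
  (hinit : forall w, P 0%N w = p /\ Q 0%N w = q)
  (hscheme : forall j w, (j < N)%N ->
     euler_step H0 sigma gamma (fun r => L r ^~ w) (t j) (t j.+1)
       (P j w) (Q j w) (P j.+1 w) (Q j.+1 w))
  (* the one-step map (P_j, Q_j) |-> (P_{j+1}, Q_{j+1}), defined on the open
     set U_j around the numerical solution *)
  (hU : forall j w, (j < N)%N -> open (U j w) /\ U j w (P j w, Q j w))
  (hmap : forall j w X, (j < N)%N -> U j w X ->
     differentiable (Pmap j w) X /\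
     euler_step H0 sigma gamma (fun r => L r ^~ w) (t j) (t j.+1)
       X.1 X.2 (Pmap j w X) (Qmap j w X))
  (hmapj : forall j w, (j < N)%N ->
     Pmap j w (P j w, Q j w) = P j.+1 w /\ Qmap j w (P j w, Q j w) = Q j.+1 w) :
  forall j w, (j < N)%N -> forall X, U j w X ->
    forall u v, wedge_form (Pmap j w) (Qmap j w) X u v = wedge_form fst snd X u v.
Proof.
move=> j w jN X UX.
have [oU _] := hU j w jN.
(* The scheme can be differentiated at [X] because it holds on a whole neighbourhood. *)
have nU : \forall Z \near X, U j w Z by exact: open_nbhs_nbhs.
(* The increments do not vary with the state, so state 0 serves as reference and the noise becomes
   the constants [c1] and [c2]. *)
pose c1 : 'rV[R]_n := \sum_(r < m)
  marcus_increment (L r ^~ w) (sigma r (t j)) (t j) (t j.+1) 0.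
pose c2 : 'rV[R]_n := \sum_(r < m)
  marcus_increment (L r ^~ w) (gamma r (t j)) (t j) (t j.+1) 0.
apply: (@implicit_map_symplectic _ _ H0 (t j.+1 - t j) c1 c2) => //.
- by have [] := hmap j w X jN UX.
- apply: filterS nU => Z /(hmap j w Z jN)[_ [ePZ _]].
  rewrite [LHS]ePZ /c1; congr (_ - _).
  by apply: eq_bigr => r _; exact: marcus_increment_cst.
- apply: filterS nU => Z /(hmap j w Z jN)[_ [_ eQZ]].
  rewrite [LHS]eQZ /c2; congr (_ + _).
  by apply: eq_bigr => r _; exact: marcus_increment_cst.
Qed.
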